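(* Let $d,g\in\mathcal{F}_0$ and $f\in\mathcal{F}_1$. If the almost-Riordan array $(d\,|\,g,f)$ is totally positive, then the Riordan array $(g,f)$ is totally positive.
   Context: For $k\ge 0$, $\mathcal{F}_k$ denotes the set of formal power series $\sum_{n\ge k}a_nt^n$ with real coefficients and $a_k\neq 0$. All matrices are infinite, with rows and columns indexed by $0,1,2,\dots$; writing a matrix as a list $(u_0,u_1,u_2,\dots)$ of formal power series means that the $(n,k)$ entry is the coefficient of $t^n$ in $u_k$. The Riordan array is $(g,f)=(g,gf,gf^2,\dots)$. The almost-Riordan array is $(d\,|\,g,f)=(d,tg,tgf,tgf^2,\dots)$, equivalently the block matrix $\begin{pmatrix} d(0)&0\\ (d-d(0))/t&(g,f)\end{pmatrix}$, where a power series in a block stands for the column of its coefficients. An infinite matrix is totally positive (TP) if its minors of all orders are nonnegative. *)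

(* Defs.v *)
From HB Require Import structures.
From mathcomp Require Import all_boot all_order all_algebra.
From mathcomp Require Import reals.

Set Implicit Arguments.
Unset Strict Implicit.
Unset Printing Implicit Defensive.

Import Order.TTheory GRing.Theory Num.Theory.
Local Open Scope ring_scope.

(* A formal power series is its coefficient sequence: [a n] is the
   coefficient of t^n. *)
Definition fps (R : Type) : Type := nat -> R.

Section PowerSeries.
Variable R : comNzRingType.
Implicit Types a b : fps R.

Definition fps_one : fps R := fun n => (n == 0)%N%:R.

Definition fps_t : fps R := fun n => (n == 1)%N%:R.

Definition fps_mul a b : fps R :=
  fun n => \sum_(i < n.+1) a i * b (n - i)%N.

Definition fps_exp a (k : nat) : fps R := iter k (fps_mul a) fps_one.

(* The class F_k of the series of order exactly k. *)
Definition in_F (k : nat) a : Prop :=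
  (forall n, (n < k)%N -> a n = 0) /\ a k <> 0.

End PowerSeries.

Arguments fps_one {R}.
Arguments fps_t {R}.

Definition infmx (R : Type) : Type := nat -> nat -> R.

Definition mx_of_cols (R : Type) (u : nat -> fps R) : infmx R :=
  fun n k => u k n.

Definition riordan (R : comNzRingType) (g f : fps R) : infmx R :=
  mx_of_cols (fun k => fps_mul g (fps_exp f k)).

Definition almost_riordan (R : comNzRingType) (d g f : fps R) : infmx R :=
  mx_of_cols (fun k =>
    if k is k'.+1 then fps_mul fps_t (fps_mul g (fps_exp f k')) else d).

Definition strictly_increasing (m : nat) (r : 'I_m -> nat) : Prop :=
  forall i j : 'I_m, (i < j)%N -> (r i < r j)%N.

Definition inf_minor (R : comNzRingType) (M : infmx R) (m : nat)
    (r c : 'I_m -> nat) : R :=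
  \det (\matrix_(i < m, j < m) M (r i) (c j)).

(* The order m = 0 is harmless: the empty minor is 1. *)
Definition totally_positive (R : numDomainType) (M : infmx R) : Prop :=
  forall (m : nat) (r c : 'I_m -> nat),
    strictly_increasing r -> strictly_increasing c -> 0 <= inf_minor M r c.

(* Main.v *)
Require Import Defs.
From HB Require Import structures.
From mathcomp Require Import all_boot all_order all_algebra.
From mathcomp Require Import reals.

Set Implicit Arguments.
Unset Strict Implicit.
Unset Printing Implicit Defensive.

Import Order.TTheory GRing.Theory Num.Theory.
Local Open Scope ring_scope.

(** Multiplication by t shifts coefficients by one, so deleting row 0 and column 0 of
    [almost_riordan d g f] leaves [riordan g f]. Hence each minor of the Riordan array is a minor of
    the almost-Riordan array, with all indices raised by one. *)

Lemma fps_mul_tS (R : comNzRingType) (a : fps R) (n : nat) :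
  fps_mul fps_t a n.+1 = a n.
Proof.
(* The terms of index 0 and 1 are split off; the others vanish with the coefficients of t. *)
rewrite /fps_mul /fps_t !big_ord_recl big1 => [|i _]; last by rewrite mul0r.
by rewrite /= mul0r mul1r add0r addr0 subn1.
Qed.

Lemma riordan_almost_riordan (R : comNzRingType) (d g f : fps R) (n k : nat) :
  riordan g f n k = almost_riordan d g f n.+1 k.+1.
Proof. by rewrite /almost_riordan /mx_of_cols fps_mul_tS. Qed.

Theorem proposition2p1 (R : realType) (d g f : fps R)
    (hd : in_F 0 d) (hg : in_F 0 g) (hf : in_F 1 f) :
  totally_positive (almost_riordan d g f) -> totally_positive (riordan g f).
Proof.
move=> tp m r c r_incr c_incr.
have -> : inf_minor (riordan g f) r c =
    inf_minor (almost_riordan d g f) (S \o r) (S \o c).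
  congr (\det _); apply/matrixP => i j.
  by rewrite !mxE (riordan_almost_riordan d).
(* Successor preserves strict increase, so the shifted indices still select a minor covered by
   [tp]. *)
by apply: tp => i j lt_ij /=; rewrite ltnS; [apply: r_incr | apply: c_incr].
Qed.
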